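(* Let $\mathcal{C}$ and $\mathcal{D}$ be abelian categories with enough projective and enough injective objects. Let $F\colon\mathcal{C}\to\mathcal{D}$ and $G\colon\mathcal{D}\to\mathcal{C}$ be functors such that $(F,G)$ is an adjoint pair, with adjunction isomorphism $$\psi=\psi_{C,D}\colon \operatorname{Hom}_{\mathcal{D}}(F(C),D)\to\operatorname{Hom}_{\mathcal{C}}(C,G(D))$$ for all $C$ in $\mathcal{C}$ and $D$ in $\mathcal{D}$. Assume that $F$ is exact and preserves projective objects. (a) The adjunction induces a functorial isomorphism $\operatorname{Ext}^i_{\mathcal{D}}(F(C),D)\simeq\operatorname{Ext}^i_{\mathcal{C}}(C,G(D))$ for all $i\ge1$ and all $C$ in $\mathcal{C}$ and $D$ in $\mathcal{D}$; this isomorphism is also denoted $\psi$. (b) For every $\eta$ in $\operatorname{Ext}^m_{\mathcal{C}}(C',C)$ and $\theta$ in $\operatorname{Ext}^n_{\mathcal{C}}(C,G(D))$ the following equality holds in $\operatorname{Ext}^{m+n}_{\mathcal{D}}(F(C'),D)$: $$\psi^{-1}(\theta)\cdot F(\eta)=\psi^{-1}(\theta\cdot\eta).$$ (c) Let $n$ be a non-negative integer. If $\operatorname{Ext}^{\ge n}_{\mathcal{C}}(C,G(D))$ is a finitely generated right $\operatorname{Ext}^*_{\mathcal{C}}(C,C)$-module, then $\operatorname{Ext}^{\ge n}_{\mathcal{D}}(F(C),D)$ is a finitely generated right $\operatorname{Ext}^*_{\mathcal{D}}(F(C),F(C))$-module. (d) If $\operatorname{Ext}^*_{\mathcal{C}}(C,C)$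 is a right Noetherian ring and $\operatorname{Ext}^*_{\mathcal{C}}(C,G(F(C)))$ is a finitely generated right $\operatorname{Ext}^*_{\mathcal{C}}(C,C)$-module, then $\operatorname{Ext}^*_{\mathcal{D}}(F(C),F(C))$ is a right Noetherian ring.
   Context: The product $\cdot$ is the Yoneda product, composed like morphisms: for $\eta\in\operatorname{Ext}^m(X,Y)$ and $\theta\in\operatorname{Ext}^n(Y,Z)$ one has $\theta\cdot\eta\in\operatorname{Ext}^{m+n}(X,Z)$. Thus $\operatorname{Ext}^*(X,X)=\bigoplus_{i\ge0}\operatorname{Ext}^i(X,X)$ is a ring and $\operatorname{Ext}^{\ge n}(X,Z)=\bigoplus_{i\ge n}\operatorname{Ext}^i(X,Z)$ is a right $\operatorname{Ext}^*(X,X)$-module. $F(\eta)$ denotes the image of $\eta$ under the map on Ext induced by the exact functor $F$. *)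

(* Defs.v *)
From HB Require Import structures.
From mathcomp Require Import all_boot all_order all_algebra.
From mathcomp Require Import generic_quotient ring_quotient boolp zify.

Set Implicit Arguments.
Unset Strict Implicit.
Unset Printing Implicit Defensive.

Import GRing.Theory.
Local Open Scope ring_scope.
Local Open Scope quotient_scope.

Reserved Notation "g ∘ f" (at level 40, left associativity).

(* Hom-sets carry the [zmodType] structure.  Its [choiceType] layer is no
   restriction, since every type has one by [boolp]. *)
Record preadditive := Preadditive {
  obj :> Type;
  Mor : obj -> obj -> zmodType;
  idm : forall X, Mor X X;
  compose : forall X Y Z, Mor Y Z -> Mor X Y -> Mor X Z;
  compA : forall W X Y Z (h : Mor Y Z) (g : Mor X Y) (f : Mor W X),
    compose h (compose g f) = compose (compose h g) f;
  comp1m : forall X Y (f : Mor X Y), compose (idm Y) f = f;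
  compm1 : forall X Y (f : Mor X Y), compose f (idm X) = f;
  compDl : forall X Y Z (g h : Mor Y Z) (f : Mor X Y),
    compose (g + h) f = compose g f + compose h f;
  compDr : forall X Y Z (h : Mor Y Z) (f g : Mor X Y),
    compose h (f + g) = compose h f + compose h g }.

Arguments Mor {_} _ _.
Arguments idm {_} _.
Notation "g ∘ f" := (compose g f).

Section PreadditiveNotions.
Variable C : preadditive.
Implicit Types X Y Z W K P Q I : C.

Definition mono X Y (f : Mor X Y) :=
  forall W (g h : Mor W X), f ∘ g = f ∘ h -> g = h.

Definition epi X Y (f : Mor X Y) :=
  forall W (g h : Mor Y W), g ∘ f = h ∘ f -> g = h.

Definition is_zero_object Z :=
  (forall X (f g : Mor X Z), f = g) /\ (forall X (f g : Mor Z X), f = g).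

Definition is_biproduct X Y S (i1 : Mor X S) (i2 : Mor Y S)
    (p1 : Mor S X) (p2 : Mor S Y) :=
  [/\ p1 ∘ i1 = idm X, p2 ∘ i2 = idm Y, p1 ∘ i2 = 0, p2 ∘ i1 = 0 &
      i1 ∘ p1 + i2 ∘ p2 = idm S].

Definition is_kernel K X Y (k : Mor K X) (f : Mor X Y) :=
  f ∘ k = 0 /\
  forall W (u : Mor W X), f ∘ u = 0 -> exists! v : Mor W K, u = k ∘ v.

Definition is_cokernel X Y Q (q : Mor Y Q) (f : Mor X Y) :=
  q ∘ f = 0 /\
  forall W (u : Mor Y W), u ∘ f = 0 -> exists! v : Mor Q W, u = v ∘ q.

(* The image of [f], i.e. the mono part [m] of its epi-mono factorization, is
   a kernel of [g]. *)
Definition exact X Y Z (f : Mor X Y) (g : Mor Y Z) :=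
  exists I (e : Mor X I) (m : Mor I Y),
    [/\ f = m ∘ e, epi e & is_kernel m g].

Definition projective_obj P :=
  forall Y Z (e : Mor Y Z), epi e -> forall f : Mor P Z, exists g, f = e ∘ g.

Definition injective_obj I :=
  forall X Y (m : Mor X Y), mono m -> forall f : Mor X I, exists g, f = g ∘ m.

Definition enough_projectives :=
  forall X, exists P (e : Mor P X), projective_obj P /\ epi e.

Definition enough_injectives :=
  forall X, exists I (m : Mor X I), injective_obj I /\ mono m.

Record is_abelian : Prop := {
  has_zero_object : exists Z, is_zero_object Z;
  has_biproducts : forall X Y, exists S (i1 : Mor X S) (i2 : Mor Y S)
    (p1 : Mor S X) (p2 : Mor S Y), is_biproduct i1 i2 p1 p2;
  has_kernels : forall X Y (f : Mor X Y), exists K (k : Mor K X), is_kernel k f;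
  has_cokernels : forall X Y (f : Mor X Y),
    exists Q (q : Mor Y Q), is_cokernel q f;
  mono_is_kernel : forall X Y (f : Mor X Y),
    mono f -> exists Z (g : Mor Y Z), is_kernel f g;
  epi_is_cokernel : forall X Y (f : Mor X Y),
    epi f -> exists W (g : Mor W X), is_cokernel f g }.

Lemma comp0m X Y Z (f : Mor X Y) : (0 : Mor Y Z) ∘ f = 0.
Proof. by apply: (addrI (0 ∘ f)); rewrite -compDl !addr0. Qed.

Lemma compm0 X Y Z (f : Mor Y Z) : f ∘ (0 : Mor X Y) = 0.
Proof. by apply: (addrI (f ∘ 0)); rewrite -compDr !addr0. Qed.

Lemma compNm X Y Z (g : Mor Y Z) (f : Mor X Y) : (- g) ∘ f = - (g ∘ f).
Proof. by apply: (addrI (g ∘ f)); rewrite -compDl !subrr comp0m. Qed.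

Lemma compmN X Y Z (g : Mor Y Z) (f : Mor X Y) : g ∘ (- f) = - (g ∘ f).
Proof. by apply: (addrI (g ∘ f)); rewrite -compDr !subrr compm0. Qed.

Lemma compBl X Y Z (g h : Mor Y Z) (f : Mor X Y) :
  (g - h) ∘ f = g ∘ f - h ∘ f.
Proof. by rewrite compDl compNm. Qed.

Lemma compBr X Y Z (h : Mor Y Z) (f g : Mor X Y) :
  h ∘ (f - g) = h ∘ f - h ∘ g.
Proof. by rewrite compDr compmN. Qed.

Lemma exact_comp X Y Z (f : Mor X Y) (g : Mor Y Z) : exact f g -> g ∘ f = 0.
Proof. by case=> I [e [m [-> _ [gm _]]]]; rewrite compA gm comp0m. Qed.

Lemma exact_lift X Y Z (f : Mor X Y) (g : Mor Y Z) P (h : Mor P Y) :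
  exact f g -> projective_obj P -> g ∘ h = 0 -> exists h', h = f ∘ h'.
Proof.
case=> I [e [m [-> ee [_ km]]]] pP /km [k [-> _]].
by have [h' ->] := pP _ _ _ ee k; exists h'; rewrite compA.
Qed.

End PreadditiveNotions.

(* An abelian category with enough projective objects. *)
Record epAbelianCategory := EpAbelianCategory {
  ab_cat :> preadditive;
  ab_abelian : is_abelian ab_cat;
  ab_projectives : enough_projectives ab_cat }.

Section Complexes.
Variable C : preadditive.

Record complex := Complex {
  cx_obj :> nat -> C;
  cx_d : forall n, Mor (cx_obj n.+1) (cx_obj n);
  cx_dd : forall n, cx_d n ∘ cx_d n.+1 = 0 }.

Record resolution (X : C) := Resolution {
  res_cx :> complex;
  res_aug : Mor (res_cx 0%N) X;
  res_aug_epi : epi res_aug;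
  res_exact0 : exact (cx_d res_cx 0) res_aug;
  res_exact : forall n, exact (cx_d res_cx n.+1) (cx_d res_cx n) }.

Definition projective_cx (A : complex) := forall n, projective_obj (A n).

Definition shift_cx (m : nat) (A : complex) : complex :=
  @Complex (fun i => A (i + m)%N) (fun i => cx_d A (i + m))
    (fun i => cx_dd A (i + m)).

(* [phi] is a chain map from [A] to [E] over [f : A 0 -> Y]. *)
Definition lifts (A : complex) Y (E : resolution Y) (f : Mor (A 0%N) Y)
    (phi : forall i, Mor (A i) (E i)) :=
  res_aug E ∘ phi 0%N = f /\
  forall i, cx_d E i ∘ phi i.+1 = phi i ∘ cx_d A i.

Section LiftExists.
Variables (A : complex) (pA : projective_cx A) (Y : C) (E : resolution Y).
Variables (f : Mor (A 0%N) Y) (f0 : f ∘ cx_d A 0 = 0).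

Let good i : Mor (A i) (E i) -> Prop :=
  match i with
  | 0 => fun g => res_aug E ∘ g ∘ cx_d A 0 = 0
  | j.+1 => fun g => cx_d E j ∘ g ∘ cx_d A j.+1 = 0
  end.

Let step i (g : {g | @good i g}) :
  {g' : {g' | @good i.+1 g'} | cx_d E i ∘ sval g' = sval g ∘ cx_d A i}.
Proof.
apply: cid; case: g => g gg /=.
suff [h hE] : exists h, g ∘ cx_d A i = cx_d E i ∘ h.
  have gh : @good i.+1 h by rewrite /= -hE -compA cx_dd compm0.
  by exists (exist _ h gh).
case: i g gg => [|i] g /= gg.
  by apply: (exact_lift (res_exact0 E) (@pA 1)); rewrite compA.
by apply: (exact_lift (res_exact E i) (@pA i.+2)); rewrite compA.
Qed.

Let init : {g | @good 0 g /\ res_aug E ∘ g = f}.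
Proof.
apply: cid; have [g fE] := pA (@res_aug_epi _ E) f.
by exists g; rewrite /= -fE.
Qed.

Let seq_lift := nat_rect (fun i => {g | @good i g})
  (exist _ (sval init) (svalP init).1) (fun i g => sval (@step i g)).

Lemma lift_exists : exists phi, lifts (E := E) f phi.
Proof.
exists (fun i => sval (seq_lift i)); split; first exact: (svalP init).2.
by move=> i; apply: (svalP (@step i (seq_lift i))).
Qed.

Definition chain_lift : forall i, Mor (A i) (E i) := sval (cid lift_exists).

Lemma chain_liftP : lifts f chain_lift.
Proof. exact: (svalP (cid lift_exists)). Qed.

End LiftExists.

Section Cocycles.
Variables (A : complex) (n : nat) (Y : C).

Definition cocycle : {pred Mor (A n) Y} := [pred f | f ∘ cx_d A n == 0].

Lemma cocycle_closed : zmod_closed cocycle.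
Proof.
split=> [|f g]; rewrite !inE ?comp0m// => /eqP fd /eqP gd.
by rewrite compBl fd gd subrr.
Qed.
HB.instance Definition _ := GRing.isZmodClosed.Build _ cocycle cocycle_closed.

(* The cocycles of the cochain complex [Mor (A, Y)]. *)
Record cocycles := Cocycles { cocv :> Mor (A n) Y; cocvP : cocv \in cocycle }.
HB.instance Definition _ := [isSub for cocv].
HB.instance Definition _ := [Choice of cocycles by <:].
HB.instance Definition _ := [SubChoice_isSubZmodule of cocycles by <:].

Lemma cocycleP (f : cocycles) : f ∘ cx_d A n = 0.
Proof. by apply/eqP; exact: cocvP. Qed.

Lemma cocycle_in (f : Mor (A n) Y) : f ∘ cx_d A n = 0 -> f \in cocycle.
Proof. by move=> fd; rewrite inE fd. Qed.

Definition mkcocycle f fd : cocycles := Cocycles (@cocycle_in f fd).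

End Cocycles.

Definition is_coboundary (A : complex) n Y : Mor (A n) Y -> Prop :=
  match n with
  | 0 => fun f => f = 0
  | k.+1 => fun f => exists g : Mor (A k) Y, f = g ∘ cx_d A k
  end.

Lemma is_coboundary0 A n Y : @is_coboundary A n Y 0.
Proof. by case: n => [|n] //=; exists 0; rewrite comp0m. Qed.

Lemma is_coboundaryD A n Y f g :
  @is_coboundary A n Y f -> @is_coboundary A n Y g -> is_coboundary (f + g).
Proof.
case: n f g => [|n] f g /= => [-> ->|[a ->] [b ->]]; first by rewrite addr0.
by exists (a + b); rewrite compDl.
Qed.

Lemma is_coboundaryN A n Y f :
  @is_coboundary A n Y f -> is_coboundary (- f).
Proof.
case: n f => [|n] f /= => [->|[a ->]]; first by rewrite oppr0.
by exists (- a); rewrite compNm.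
Qed.

Lemma is_coboundary_compl A n Y Z (v : Mor Y Z) f :
  @is_coboundary A n Y f -> is_coboundary (v ∘ f).
Proof.
case: n f => [|n] f /= => [->|[a ->]]; first by rewrite compm0.
by exists (v ∘ a); rewrite compA.
Qed.

Lemma is_coboundary_shift m (A : complex) n Y (f : Mor (A (n + m)%N) Y) :
  @is_coboundary (shift_cx m A) n Y f -> is_coboundary f.
Proof. by case: n f => [|n] f //= ->; apply: is_coboundary0. Qed.

Definition coboundary A n Y : {pred cocycles A n Y} :=
  fun f => `[< is_coboundary (f : Mor (A n) Y) >].

Lemma coboundary_closed A n Y : zmod_closed (@coboundary A n Y).
Proof.
split=> [|f g]; first by apply/asboolP; apply: is_coboundary0.
move=> /asboolP fB /asboolP gB; apply/asboolP.
by apply: is_coboundaryD fB (is_coboundaryN gB).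
Qed.
HB.instance Definition _ A n Y :=
  GRing.isZmodClosed.Build _ (@coboundary A n Y) (@coboundary_closed A n Y).

Section ChainMaps.
Variables (A : complex) (Y : C) (E : resolution Y).

Lemma lifts_cocycle f phi n Z (z : cocycles E n Z) :
  @lifts A Y E f phi -> (z ∘ phi n) ∘ cx_d A n = 0.
Proof.
by move=> [_ dphi]; rewrite -compA -dphi compA cocycleP comp0m.
Qed.

Lemma liftsB f g phi psi : @lifts A Y E f phi -> @lifts A Y E g psi ->
  lifts (E := E) (f - g) (fun i => phi i - psi i).
Proof.
move=> [pf dp] [qg dq]; split=> [|i]; first by rewrite compBr pf qg.
by rewrite compBr compBl dp dq.
Qed.

Lemma liftsD f g phi psi : @lifts A Y E f phi -> @lifts A Y E g psi ->
  lifts (E := E) (f + g) (fun i => phi i + psi i).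
Proof.
move=> [pf dp] [qg dq]; split=> [|i]; first by rewrite compDr pf qg.
by rewrite compDr compDl dp dq.
Qed.

Lemma is_coboundary_compr f phi n Z z :
  @lifts A Y E f phi -> @is_coboundary E n Z z -> is_coboundary (z ∘ phi n).
Proof.
move=> [_ dphi]; case: n z => [|n] z /= => [->|[a ->]]; first exact: comp0m.
by exists (a ∘ phi n); rewrite -!compA dphi.
Qed.

Hypothesis pA : projective_cx A.

Lemma lifts0_coboundary phi n Z (z : cocycles E n Z) :
  @lifts A Y E 0 phi -> is_coboundary (z ∘ phi n).
Proof.
move=> [phi0 dphi].
have homotopy k : exists s, is_coboundary (phi k - cx_d E k ∘ s).
  elim: k => [|k [s sP]] /=.
    have [s ->] := exact_lift (res_exact0 E) (@pA 0%N) phi0.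
    by exists s; rewrite subrr.
  have sd : (phi k - cx_d E k ∘ s) ∘ cx_d A k = 0.
    case: k s sP => [|k] s /= => [->|[a ->]]; first by rewrite comp0m.
    by rewrite -compA cx_dd compm0.
  have [|s' s'E] := @exact_lift _ _ _ _ _ _ _ (phi k.+1 - s ∘ cx_d A k)
    (res_exact E k) (@pA k.+1).
    by rewrite compBr dphi compA -compBl.
  by exists s', s; rewrite -s'E opprB addrC subrK.
have [s sP] := homotopy n.
suff -> : z ∘ phi n = z ∘ (phi n - cx_d E n ∘ s)
  by apply: is_coboundary_compl.
by rewrite compBr compA cocycleP comp0m subr0.
Qed.

Lemma lifts_eq_coboundary f phi psi n Z (z : cocycles E n Z) :
  @lifts A Y E f phi -> @lifts A Y E f psi ->
  is_coboundary (z ∘ phi n - z ∘ psi n).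
Proof.
move=> pf qf; have := liftsB pf qf; rewrite subrr -compBr.
exact: lifts0_coboundary.
Qed.

End ChainMaps.

Lemma lifts_shift_coboundary A m Y (E : resolution Y) f phi n Z
    (z : cocycles E n Z) : projective_cx A ->
  @lifts (shift_cx m A) Y E f phi -> @is_coboundary A m Y f ->
  @is_coboundary A (n + m) Z (z ∘ phi n).
Proof.
move=> pA; have pS k : projective_cx (shift_cx k A) by move=> i; apply: pA.
case: m f phi => [|m] f phi pf /= fB.
  by apply/is_coboundary_shift/lifts0_coboundary => //; rewrite -fB.
case: fB => h fE; have [h0 hE] := pA _ _ _ _ (@res_aug_epi _ E) h.
pose chi i : Mor (shift_cx m.+1 A i) (E i) :=
  match i with 0 => h0 ∘ cx_d A m | _.+1 => 0 end.
have chiP : @lifts (shift_cx m.+1 A) _ E f chi.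
  split=> [|[|i]]; rewrite /= ?compm0 ?comp0m//.
    by rewrite compA -hE fE.
  by rewrite -compA (cx_dd A m) compm0.
have zB : @is_coboundary A (n + m.+1) Z (z ∘ chi n).
  case: (n) z => [|k] z /=; last by exists 0; rewrite compm0 comp0m.
  by exists (z ∘ h0); rewrite compA.
rewrite -(subrK (z ∘ chi n) (z ∘ phi n)); apply: is_coboundaryD zB.
exact/is_coboundary_shift/(lifts_eq_coboundary (pS _) z pf chiP).
Qed.

End Complexes.

Section ProjectiveResolution.
Variables (C : epAbelianCategory) (X : C).

Let arrow := {A : C & {B : C & Mor A B}}.
Let src (s : arrow) : C := projT1 s.
Let tgt (s : arrow) : C := projT1 (projT2 s).
Let mor (s : arrow) : Mor (src s) (tgt s) := projT2 (projT2 s).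

Let next (s : arrow) :
  {Q : C & {d : Mor Q (src s) | projective_obj Q /\ exact d (mor s)}}.
Proof.
suff /cid[Q /cid dP] : exists Q (d : Mor Q (src s)),
  projective_obj Q /\ exact d (mor s) by exists Q.
have [K [k kP]] := has_kernels (ab_abelian C) (mor s).
have [Q [e [pQ ee]]] := ab_projectives K.
by exists Q, (k ∘ e); split=> //; exists K, e, k.
Qed.

Let start : {P : C & {e : Mor P X | projective_obj P /\ epi e}}.
Proof. by have /cid[P /cid eP] := ab_projectives X; exists P. Qed.

Let step (s : arrow) : arrow :=
  existT _ (projT1 (next s)) (existT _ (src s) (sval (projT2 (next s)))).

Let s n :=
  iter n step (existT _ (projT1 start) (existT _ X (sval (projT2 start)))).

Lemma projective_resolution_exists :
  exists P : resolution X, projective_cx P.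
Proof.
pose d n : Mor (src (s n.+1)) (src (s n)) := mor (s n.+1).
have dex n : exact (d n) (mor (s n)) := (svalP (projT2 (next (s n)))).2.
have dd n : d n ∘ d n.+1 = 0 by apply: exact_comp (dex n.+1).
exists (@Resolution _ X (Complex dd) (sval (projT2 start))
  (svalP (projT2 start)).2 (dex 0%N) (fun n => dex n.+1)).
by case=> [|n] /=; [case: (svalP (projT2 start)) |
  case: (svalP (projT2 (next (s n))))].
Qed.

Definition PR : resolution X := sval (cid projective_resolution_exists).

Lemma PR_proj : projective_cx PR.
Proof. exact: (svalP (cid projective_resolution_exists)). Qed.

Lemma PR_shift_proj m : projective_cx (shift_cx m PR).
Proof. by move=> i; apply: PR_proj. Qed.

End ProjectiveResolution.

Section Ext.
Variable C : epAbelianCategory.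
Implicit Types X Y Z W : C.

(* The [n]-th cohomology group of [Mor (P, Y)] for the chosen projective
   resolution [P = PR X] of [X]. *)
Definition Ext (n : nat) X Y := Quotient.quot (@coboundary C (PR X) n Y).
HB.instance Definition _ n X Y := GRing.Zmodule.on (Ext n X Y).

Definition ext_pi n X Y (f : cocycles (PR X) n Y) : Ext n X Y := \pi f.
HB.instance Definition _ n X Y :=
  GRing.Additive.copy (@ext_pi n X Y)
    (\pi_(Quotient.quot (@coboundary C (PR X) n Y))).

Definition ext_repr n X Y (x : Ext n X Y) : cocycles (PR X) n Y := repr x.

Lemma ext_reprK n X Y : cancel (@ext_repr n X Y) (@ext_pi n X Y).
Proof. exact: reprK. Qed.

Lemma ext_piP n X Y (f g : cocycles (PR X) n Y) :
  reflect (ext_pi f = ext_pi g) `[< is_coboundary (cocv f - cocv g) >].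
Proof.
by apply: (iffP idP) => [|/eqmodP]; [move=> h; apply/eqmodP|];
  rewrite /= /Quotient.equiv /in_mem.
Qed.
End Ext.

Section Yoneda.
Variable C : epAbelianCategory.
Implicit Types X Y Z W : C.

Definition ext_cast X Y n n' (e : n = n') (x : Ext n X Y) : Ext n' X Y :=
  ecast k (Ext k X Y) e x.

Definition chain_cocycle (A : complex C) Y (E : resolution Y) f phi
    (pf : @lifts C A Y E f phi) n Z (g : cocycles E n Z) : cocycles A n Z :=
  mkcocycle (lifts_cocycle g pf).

Definition unshift_cocycle m (A : complex C) n Z
    (f : cocycles (shift_cx m A) n Z) : cocycles A (n + m) Z :=
  @mkcocycle C A (n + m) Z f (cocycleP f).

(* The class of a cocycle [f] on an arbitrary, not necessarily projective,
   resolution [E] of [X]. *)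
Definition ext_class X (E : resolution X) n Y (f : cocycles E n Y) :
    Ext n X Y :=
  ext_pi (chain_cocycle
    (chain_liftP (@PR_proj C X) E (exact_comp (res_exact0 (PR X)))) f).

(* The covariant and contravariant actions of morphisms on Ext. *)
Definition ext_push n X Y Y' (v : Mor Y Y') (x : Ext n X Y) : Ext n X Y' :=
  ext_pi (mkcocycle (f := v ∘ ext_repr x)
    (etrans (esym (compA _ _ _))
       (etrans (congr1 (compose v) (cocycleP (ext_repr x))) (compm0 _ _)))).

Lemma aug_pull_cocycle X X' (u : Mor X' X) :
  u ∘ res_aug (PR X') ∘ cx_d (PR X') 0 = 0.
Proof. by rewrite -compA (exact_comp (res_exact0 (PR X'))) compm0. Qed.

Definition ext_pull n X X' Y (u : Mor X' X) (x : Ext n X Y) : Ext n X' Y :=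
  ext_pi (chain_cocycle
    (chain_liftP (@PR_proj C X') (PR X) (aug_pull_cocycle u)) (ext_repr x)).

(* The identification of [Mor X Y] with [Ext 0 X Y]. *)
Definition ext_of_hom X Y (u : Mor X Y) : Ext 0 X Y :=
  ext_pi (mkcocycle (aug_pull_cocycle u)).

(* The Yoneda product: a cocycle [f : P_m -> Y] lifts to a chain map from
   [P_(i + m)] to the resolution of [Y], whose component in degree [n] is
   composed with the cocycle on the left. *)
Definition yoneda n m X Y Z (y : Ext n Y Z) (x : Ext m X Y) : Ext (n + m) X Z :=
  ext_pi (unshift_cocycle (chain_cocycle
    (chain_liftP (@PR_shift_proj C X m) (PR Y) (cocycleP (ext_repr x)))
    (ext_repr y))).

Lemma ext_pi_eq n X Y (f g : cocycles (PR X) n Y) :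
  is_coboundary (cocv f - cocv g) -> ext_pi f = ext_pi g.
Proof. by move=> fg; apply/ext_piP/asboolP. Qed.

Lemma ext_repr_pi n X Y (f : cocycles (PR X) n Y) :
  is_coboundary (cocv (ext_repr (ext_pi f)) - cocv f).
Proof. by apply/asboolP/ext_piP; rewrite ext_reprK. Qed.

Lemma ext_classE X (E : resolution X) n Y (f : cocycles E n Y)
    phi (pf : lifts (E := E) (res_aug (PR X)) phi) :
  ext_class f = ext_pi (chain_cocycle pf f).
Proof.
apply: ext_pi_eq => /=; apply: (lifts_eq_coboundary (@PR_proj C X) f _ pf).
exact: chain_liftP.
Qed.

Lemma ext_class_coboundary X (E : resolution X) n Y (f g : cocycles E n Y) :
  is_coboundary (cocv f - cocv g) -> ext_class f = ext_class g.
Proof.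
move=> fg; apply: ext_pi_eq; rewrite /= -compBl.
exact: is_coboundary_compr (chain_liftP _ _ _) fg.
Qed.

Lemma ext_class_PR X n Y (f : cocycles (PR X) n Y) : ext_class f = ext_pi f.
Proof.
have idl : lifts (E := PR X) (res_aug (PR X)) (fun i => idm (PR X i)).
  by split=> [|i]; rewrite ?compm1 ?comp1m.
by rewrite (ext_classE _ idl); congr ext_pi; apply/val_inj; rewrite /= compm1.
Qed.

Lemma ext_push_pi n X Y Y' (v : Mor Y Y') (f : cocycles (PR X) n Y)
  (g : cocycles (PR X) n Y') :
  cocv g = v ∘ f -> ext_push v (ext_pi f) = ext_pi g.
Proof.
move=> gE; apply: ext_pi_eq; rewrite /= gE -compBr.
exact/is_coboundary_compl/ext_repr_pi.
Qed.

Lemma ext_pull_pi n X X' Y (u : Mor X' X) (f : cocycles (PR X) n Y) phi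
    (pf : lifts (E := PR X) (u ∘ res_aug (PR X')) phi) :
  ext_pull u (ext_pi f) = ext_pi (chain_cocycle pf f).
Proof.
apply: ext_pi_eq => /=; rewrite -(subrK (f ∘ chain_lift (@PR_proj C X') (PR X)
  (aug_pull_cocycle u) n) (_ ∘ _)) -addrA -compBl.
apply: is_coboundaryD.
  exact: is_coboundary_compr (chain_liftP _ _ _) (ext_repr_pi f).
by apply: (lifts_eq_coboundary (@PR_proj C X') f _ pf); apply: chain_liftP.
Qed.

Lemma yoneda_pi n m X Y Z (g : cocycles (PR Y) n Z) (f : cocycles (PR X) m Y)
    phi (pf : @lifts C (shift_cx m (PR X)) Y (PR Y) f phi) :
  yoneda (ext_pi g) (ext_pi f) =
  ext_pi (unshift_cocycle (chain_cocycle pf g)).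
Proof.
apply: ext_pi_eq; rewrite /=.
set psi := chain_lift _ _ _; have qf : lifts _ psi := chain_liftP _ _ _.
rewrite -(subrK (g ∘ psi n) (_ ∘ _)) -addrA -compBl.
apply: (@is_coboundaryD C (PR X) (n + m) Z).
  exact/is_coboundary_shift/(is_coboundary_compr qf)/ext_repr_pi.
rewrite -compBr.
exact: (lifts_shift_coboundary g (@PR_proj C X) (liftsB qf pf) (ext_repr_pi f)).
Qed.

Lemma lifts_of m X Y (f : cocycles (PR X) m Y) :
  exists phi, @lifts C (shift_cx m (PR X)) Y (PR Y) f phi.
Proof. by have := lift_exists (@PR_shift_proj C X m) (PR Y) (cocycleP f). Qed.

Lemma yonedaDl n m X Y Z (y y' : Ext n Y Z) (x : Ext m X Y) :
  yoneda (y + y') x = yoneda y x + yoneda y' x.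
Proof.
rewrite -[y]ext_reprK -[y']ext_reprK -[x]ext_reprK -raddfD.
have [phi pf] := lifts_of (ext_repr x).
rewrite !(yoneda_pi _ pf) -raddfD; congr ext_pi.
by apply/val_inj; rewrite /= compDl.
Qed.

Lemma yonedaDr n m X Y Z (y : Ext n Y Z) (x x' : Ext m X Y) :
  yoneda y (x + x') = yoneda y x + yoneda y x'.
Proof.
rewrite -[y]ext_reprK -[x]ext_reprK -[x']ext_reprK -raddfD.
have [phi pf] := lifts_of (ext_repr x).
have [psi qf] := lifts_of (ext_repr x').
rewrite (yoneda_pi _ pf) (yoneda_pi _ qf) 
  (yoneda_pi (f := ext_repr x + ext_repr x') _ (liftsD pf qf)) -raddfD.
by congr ext_pi; apply/val_inj; rewrite /= compDr.
Qed.

Lemma yoneda0l n m X Y Z (x : Ext m X Y) : yoneda (0 : Ext n Y Z) x = 0.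
Proof. by apply: (addrI (yoneda 0 x)); rewrite -yonedaDl !addr0. Qed.

Lemma yoneda0r n m X Y Z (y : Ext n Y Z) : yoneda y (0 : Ext m X Y) = 0.
Proof. by apply: (addrI (yoneda y 0)); rewrite -yonedaDr !addr0. Qed.

Lemma ext_castD X Y n n' (e : n = n') :
  {morph @ext_cast X Y n n' e : x y / x + y}.
Proof. by case: n' / e. Qed.

Lemma ext_cast0 X Y n n' (e : n = n') : @ext_cast X Y n n' e 0 = 0.
Proof. by case: n' / e. Qed.

Let idcast (A : complex C) a b (e : a = b) : Mor (A a) (A b) :=
  ecast k (Mor (A a) (A k)) e (idm (A a)).

Let idcastP (A : complex C) a b (e : a = b) (e' : a.+1 = b.+1) :
  cx_d A b ∘ idcast A e' = idcast A e ∘ cx_d A a.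
Proof.
case: b / e e' => e'; rewrite (eq_irrelevance e' erefl).
by rewrite /idcast /= compm1 comp1m.
Qed.

Let ext_cast_pi X Y n n' (e : n = n') (f : cocycles (PR X) n Y) g :
  cocv g = f ∘ idcast (PR X) (esym e) -> ext_cast e (ext_pi f) = ext_pi g.
Proof.
case: n' / e g => g /= gE; congr ext_pi; apply/val_inj.
by rewrite /= gE compm1.
Qed.

Lemma yonedaA k n m W X Y Z (z : Ext k Y Z) (y : Ext n X Y) (x : Ext m W X) :
  yoneda z (yoneda y x) =
  ext_cast (esym (addnA k n m)) (yoneda (yoneda z y) x).
Proof.
rewrite -[z]ext_reprK -[y]ext_reprK -[x]ext_reprK.
have [phi pf] := lifts_of (ext_repr x); have [psi qf] := lifts_of (ext_repr y).
rewrite (yoneda_pi _ pf) (yoneda_pi _ qf).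
pose chi i : Mor (shift_cx (n + m) (PR W) i) (PR Y i) :=
  psi i ∘ phi (i + n)%N ∘ idcast (PR W) (addnA i n m).
have chiP : @lifts C (shift_cx (n + m) (PR W)) Y (PR Y)
    (ext_repr y ∘ phi n) chi.
  split=> [|i]; first by
    rewrite /chi /= (eq_irrelevance (addnA 0 n m) erefl) compm1 compA qf.1.
  rewrite /chi !compA qf.2 -(compA (psi i)) (pf.2 (i + n)%N) -!compA.
  congr (_ ∘ (_ ∘ _)).
  exact: (@idcastP (PR W) _ _ (addnA i n m) (addnA i.+1 n m)).
rewrite (yoneda_pi (f := unshift_cocycle (chain_cocycle pf (ext_repr y)))
  (ext_repr z) chiP).
rewrite (yoneda_pi (unshift_cocycle (chain_cocycle qf (ext_repr z))) pf).
apply/esym/ext_cast_pi; rewrite /= /chi !compA esymK.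
by congr (_ ∘ idcast _ _); apply: eq_irrelevance.
Qed.

Lemma yoneda1l m X Y (x : Ext m X Y) : yoneda (ext_of_hom (idm Y)) x = x.
Proof.
rewrite -[x]ext_reprK; have [phi pf] := lifts_of (ext_repr x).
rewrite (yoneda_pi _ pf); congr ext_pi.
by apply/val_inj; rewrite /= comp1m pf.1.
Qed.

Lemma yoneda1r n X Y (x : Ext n X Y) :
  yoneda x (ext_of_hom (idm X)) = ext_cast (esym (addn0 n)) x.
Proof.
rewrite -[x]ext_reprK.
have pf : @lifts C (shift_cx 0 (PR X)) X (PR X)
    (mkcocycle (aug_pull_cocycle (idm X)))
    (fun i => idcast (PR X) (addn0 i)).
  split=> [|i]; last exact: (@idcastP (PR X) _ _ (addn0 i) (addn0 i.+1)).
  by rewrite /= comp1m (eq_irrelevance (addn0 0) erefl) compm1.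
rewrite (yoneda_pi _ pf); apply/esym/ext_cast_pi => /=.
by congr (_ ∘ idcast _ _); apply: eq_irrelevance.
Qed.

End Yoneda.

Section DirectSum.
Variable M : nat -> zmodType.

Record dsum := Dsum {
  dsum_val :> forall i, M i;
  dsum_fin : exists N, forall i, (N <= i)%N -> dsum_val i = 0 }.

HB.instance Definition _ := gen_eqMixin dsum.
HB.instance Definition _ := gen_choiceMixin dsum.

Lemma dsumP (x y : dsum) : (forall i, x i = y i) -> x = y.
Proof.
case: x y => [x xP] [y yP] /= xy; have {}xy : x = y.
  exact: functional_extensionality_dep.
by case: y / xy yP => yP; congr Dsum; apply: Prop_irrelevance.
Qed.

Let zero : dsum := @Dsum (fun=> 0) (ex_intro _ 0%N (fun _ _ => erefl)).

Let add_fin (x y : dsum) : exists N, forall i, (N <= i)%N -> x i + y i = 0.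
Proof.
have [[N xN] [K yK]] := (dsum_fin x, dsum_fin y).
by exists (maxn N K) => i; rewrite geq_max => /andP[/xN-> /yK->]; rewrite addr0.
Qed.

Let opp_fin (x : dsum) : exists N, forall i, (N <= i)%N -> - x i = 0.
Proof. by have [N xN] := dsum_fin x; exists N => i /xN->; rewrite oppr0. Qed.

Let add x y := Dsum (add_fin x y).
Let opp x := Dsum (opp_fin x).

Let addA : associative add.
Proof. by move=> x y z; apply: dsumP => i; apply: addrA. Qed.
Let addC : commutative add.
Proof. by move=> x y; apply: dsumP => i; apply: addrC. Qed.
Let add0 : left_id zero add.
Proof. by move=> x; apply: dsumP => i; apply: add0r. Qed.
Let addN : left_inverse zero opp add.
Proof. by move=> x; apply: dsumP => i; apply: addNr. Qed.

HB.instance Definition _ := GRing.isZmodule.Build dsum addA addC add0 addN.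

Lemma dsum0E i : (0 : dsum) i = 0. Proof. by []. Qed.
Lemma dsumDE (x y : dsum) i : (x + y) i = x i + y i. Proof. by []. Qed.

Definition dsum_inj_fun n (a : M n) i : M i :=
  if n =P i is ReflectT e then ecast k (M k) e a else 0.

Lemma dsum_inj_fin n (a : M n) :
  exists N, forall i, (N <= i)%N -> dsum_inj_fun a i = 0.
Proof.
exists n.+1 => i ni; rewrite /dsum_inj_fun; case: eqP => // e.
by exfalso; lia.
Qed.

Definition dsum_inj n (a : M n) : dsum := Dsum (dsum_inj_fin a).

End DirectSum.

Section TotalExt.
Variable C : epAbelianCategory.
Implicit Types W X Y Z : C.

Definition ExtTot X Y := dsum (fun i => Ext i X Y).
HB.instance Definition _ X Y := GRing.Zmodule.on (ExtTot X Y).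

Definition tot_mul_fun X Y Z (y : ExtTot Y Z) (x : ExtTot X Y) k : Ext k X Z :=
  \sum_(i < k.+1) ext_cast (subnK (leq_ord i)) (yoneda (y (k - i)%N) (x i)).

Lemma tot_mul_fin X Y Z (y : ExtTot Y Z) (x : ExtTot X Y) :
  exists N, forall k, (N <= k)%N -> tot_mul_fun y x k = 0.
Proof.
have [[N yN] [K xK]] := (dsum_fin y, dsum_fin x).
exists (N + K)%N => k Nk; apply: big1 => i _.
case: (leqP K i) => iK; first by rewrite xK// yoneda0r ext_cast0.
by rewrite yN ?yoneda0l ?ext_cast0// leq_subRL; lia.
Qed.

Definition tot_mul X Y Z (y : ExtTot Y Z) (x : ExtTot X Y) : ExtTot X Z :=
  Dsum (tot_mul_fin y x).

Let gmul a b k X Y Z (y : Ext a Y Z) (x : Ext b X Y) : Ext k X Z :=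
  if (a + b)%N =P k is ReflectT e then ext_cast e (yoneda y x) else 0.

Let gmulDl a b k X Y Z (x : Ext b X Y) :
  {morph (fun y : Ext a Y Z => gmul k y x) : y y' / y + y'}.
Proof.
move=> y y'; rewrite /gmul; case: eqP => [e|_]; last by rewrite addr0.
by rewrite yonedaDl ext_castD.
Qed.

Let gmulDr a b k X Y Z (y : Ext a Y Z) :
  {morph (@gmul a b k X Y Z y) : x x' / x + x'}.
Proof.
move=> x x'; rewrite /gmul; case: eqP => [e|_]; last by rewrite addr0.
by rewrite yonedaDr ext_castD.
Qed.

Let gmul0l a b k X Y Z (x : Ext b X Y) : gmul k (0 : Ext a Y Z) x = 0.
Proof. by rewrite /gmul; case: eqP => // e; rewrite yoneda0l ext_cast0. Qed.

Let gmul0r a b k X Y Z (y : Ext a Y Z) : gmul k y (0 : Ext b X Y) = 0.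
Proof. by rewrite /gmul; case: eqP => // e; rewrite yoneda0r ext_cast0. Qed.

Let gmul_neq a b k X Y Z (y : Ext a Y Z) (x : Ext b X Y) :
  (a + b)%N != k -> gmul k y x = 0.
Proof. by rewrite /gmul; case: eqP. Qed.

Let gmul_suml a b k X Y Z (x : Ext b X Y) N (F : 'I_N -> Ext a Y Z) :
  gmul k (\sum_i F i) x = \sum_i gmul k (F i) x.
Proof.
apply: (big_morph (fun y : Ext a Y Z => gmul k y x)) => [y y'|].
  exact: gmulDl.
exact: gmul0l.
Qed.

Let gmul_sumr a b k X Y Z (y : Ext a Y Z) N (F : 'I_N -> Ext b X Y) :
  gmul k y (\sum_i F i) = \sum_i gmul k y (F i).
Proof.
apply: (big_morph (gmul k y)) => [x x'|]; first exact: gmulDr.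
exact: gmul0r.
Qed.

Let tot_mulE X Y Z (y : ExtTot Y Z) (x : ExtTot X Y) k N : (k < N)%N ->
  tot_mul y x k = \sum_(b < N) \sum_(a < N) gmul k (y a) (x b).
Proof.
move=> kN; pose G b := \sum_(a < N) gmul k (y a) (x b).
transitivity (\sum_(b < k.+1) G b); last first.
  rewrite (big_ord_widen N G kN) big_mkcond /=; apply: eq_bigr => b _.
  case: ifP => // bk; rewrite /G big1// => a _; rewrite gmul_neq//; lia.
apply: eq_bigr => b _; have bk := leq_ord b.
have aN : (k - b < N)%N by lia.
rewrite /G (bigD1 (Ordinal aN))//= big1 ?addr0; last first.
  by move=> a; rewrite -val_eqE /= => ab; rewrite gmul_neq//; lia.
rewrite /gmul; case: eqP => [e'|ne]; last by exfalso; lia.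
by congr ext_cast; apply: eq_irrelevance.
Qed.

Let gmul_cast a b k k' (e : k = k') X Y Z (y : Ext a Y Z) (x : Ext b X Y) :
  gmul k' y x = ext_cast e (gmul k y x).
Proof. by case: k' / e. Qed.

Let gmulE a b X Y Z (y : Ext a Y Z) (x : Ext b X Y) :
  gmul (a + b) y x = yoneda y x.
Proof.
by rewrite /gmul; case: eqP => // e; rewrite (eq_irrelevance e erefl).
Qed.

Let gmulAl a b c k N W X Y Z (z : Ext a Y Z) (y : Ext b X Y) (x : Ext c W X) :
  (k < N)%N ->
  \sum_(i < N) gmul k z (gmul i y x) = gmul k z (yoneda y x).
Proof.
move=> kN; case: (ltnP (b + c) N) => bcN; last first.
  rewrite [RHS]gmul_neq; last by lia.
  by apply: big1 => i _; rewrite [gmul i y x]gmul_neq ?gmul0r//;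
    have := ltn_ord i; lia.
rewrite (bigD1 (Ordinal bcN))//= big1 ?addr0 ?gmulE// => i.
by rewrite -val_eqE /= eq_sym => ibc; rewrite [gmul i y x]gmul_neq ?gmul0r.
Qed.

Let gmulAr a b c k N W X Y Z (z : Ext a Y Z) (y : Ext b X Y) (x : Ext c W X) :
  (k < N)%N ->
  \sum_(i < N) gmul k (gmul i z y) x = gmul k (yoneda z y) x.
Proof.
move=> kN; case: (ltnP (a + b) N) => abN; last first.
  rewrite [RHS]gmul_neq; last by lia.
  by apply: big1 => i _; rewrite [gmul i z y]gmul_neq ?gmul0l//;
    have := ltn_ord i; lia.
rewrite (bigD1 (Ordinal abN))//= big1 ?addr0 ?gmulE// => i.
by rewrite -val_eqE /= eq_sym => iab; rewrite [gmul i z y]gmul_neq ?gmul0l.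
Qed.

Let ext_cast_trans a b c (e : a = b) (e' : b = c) X Y (x : Ext a X Y) :
  ext_cast e' (ext_cast e x) = ext_cast (etrans e e') x.
Proof. by case: c / e'; case: b / e. Qed.

Let gmulA a b c k W X Y Z (z : Ext a Y Z) (y : Ext b X Y) (x : Ext c W X) :
  gmul k z (yoneda y x) = gmul k (yoneda z y) x.
Proof.
rewrite /gmul; case: eqP => e; case: eqP => e' //; try by exfalso; lia.
rewrite yonedaA ext_cast_trans.
by congr ext_cast; apply: eq_irrelevance.
Qed.

Lemma tot_mulA W X Y Z (z : ExtTot Y Z) (y : ExtTot X Y) (x : ExtTot W X) :
  tot_mul z (tot_mul y x) = tot_mul (tot_mul z y) x.
Proof.
apply: dsumP => k; rewrite !(@tot_mulE _ _ _ _ _ k k.+1)//.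
transitivity (\sum_(a < k.+1) \sum_(c < k.+1) \sum_(b < k.+1)
    gmul k (z a) (yoneda (y b) (x c))).
  rewrite exchange_big; apply: eq_bigr => a _.
  under eq_bigr => i _.
    rewrite (tot_mulE _ _ (ltn_ord i)) gmul_sumr.
    under eq_bigr do rewrite gmul_sumr.
    over.
  rewrite exchange_big; apply: eq_bigr => c _.
  by rewrite exchange_big; apply: eq_bigr => b _; rewrite gmulAl.
rewrite exchange_big; apply: eq_bigr => c _.
transitivity (\sum_(i < k.+1) \sum_(b < k.+1) \sum_(a < k.+1)
    gmul k (gmul i (z a) (y b)) (x c)).
  rewrite exchange_big [RHS]exchange_big; apply: eq_bigr => b _.
  rewrite [RHS]exchange_big; apply: eq_bigr => a _.
  by rewrite gmulAr// gmulA.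
apply: eq_bigr => i _; rewrite (tot_mulE _ _ (ltn_ord i)) gmul_suml.
by apply: eq_bigr => b _; rewrite gmul_suml.
Qed.

Lemma tot_mulDl X Y Z (x : ExtTot X Y) :
  {morph (fun y : ExtTot Y Z => tot_mul y x) : y y' / y + y'}.
Proof.
move=> y y'; apply: dsumP => k; rewrite dsumDE /= /tot_mul_fun -big_split.
by apply: eq_bigr => i _; rewrite dsumDE yonedaDl ext_castD.
Qed.

Lemma tot_mulDr X Y Z (y : ExtTot Y Z) :
  {morph (@tot_mul X Y Z y) : x x' / x + x'}.
Proof.
move=> x x'; apply: dsumP => k; rewrite dsumDE /= /tot_mul_fun -big_split.
by apply: eq_bigr => i _; rewrite dsumDE yonedaDr ext_castD.
Qed.

Definition tot_one X : ExtTot X X :=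
  @dsum_inj (fun i => Ext i X X) 0 (ext_of_hom (idm X)).

Let tot_one0 X : tot_one X 0%N = ext_of_hom (idm X).
Proof.
rewrite /tot_one /= /dsum_inj_fun; case: eqP => // e.
by rewrite (eq_irrelevance e erefl).
Qed.

Let tot_one_neq X i : i != 0%N -> tot_one X i = 0.
Proof. by rewrite /tot_one /= /dsum_inj_fun eq_sym; case: eqP. Qed.

Let big_only (V : zmodType) N (i : 'I_N) (F : 'I_N -> V) :
  (forall j, j != i -> F j = 0) -> \sum_j F j = F i.
Proof. by move=> Fi; rewrite (bigD1 i)//= big1// addr0. Qed.

Lemma tot_mul1l X Y (x : ExtTot X Y) : tot_mul (tot_one Y) x = x.
Proof.
apply: dsumP => k; rewrite (tot_mulE _ _ (ltnSn k)) (big_only (i := ord_max)).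
  rewrite (big_only (i := ord0)); last first.
    by move=> a a0; rewrite tot_one_neq ?gmul0l.
  by rewrite tot_one0 (@gmulE 0 k) yoneda1l.
move=> b bk; rewrite big1// => a _; case: (eqVneq (a : nat) 0%N) => a0.
  by rewrite gmul_neq// a0; move: bk; rewrite -val_eqE.
by rewrite tot_one_neq ?gmul0l.
Qed.

Lemma tot_mul1r X Y (x : ExtTot X Y) : tot_mul x (tot_one X) = x.
Proof.
apply: dsumP => k; rewrite (tot_mulE _ _ (ltnSn k)) (big_only (i := ord0)).
  rewrite (big_only (i := ord_max)); last first.
    by move=> a ak; rewrite gmul_neq// addn0; move: ak; rewrite -val_eqE.
  rewrite tot_one0 (gmul_cast (addn0 k)) gmulE yoneda1r.
  by rewrite ext_cast_trans (eq_irrelevance (etrans _ _) erefl).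
move=> b b0; rewrite big1// => a _.
by rewrite tot_one_neq ?gmul0r.
Qed.

Definition ExtRing X := ExtTot X X.
HB.instance Definition _ X := GRing.Zmodule.on (ExtRing X).
HB.instance Definition _ X := GRing.Zmodule_isPzRing.Build (ExtRing X)
  (@tot_mulA X X X X) (@tot_mul1l X X) (@tot_mul1r X X)
  (fun x y z => @tot_mulDl X X X z x y) (fun x y z => @tot_mulDr X X X x y z).

(* A right [ExtRing X]-module is a left module over the converse ring, so that
   [r *: y] stands for the Yoneda product of [y] by [r] on the right. *)
Definition ExtMod X Z := ExtTot X Z.
HB.instance Definition _ X Z := GRing.Zmodule.on (ExtMod X Z).
HB.instance Definition _ X Z :=
  GRing.Zmodule_isLmodule.Build (ExtRing X)^c (ExtMod X Z)
    (scale := fun r y => tot_mul y r)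
    (fun a b y => esym (tot_mulA y b a)) (@tot_mul1r X Z)
    (fun r y y' => tot_mulDl r y y') (fun y => tot_mulDr y).

(* [Ext^{>= n}] as a submodule of the total Ext. *)
Definition ext_ge n X Z (x : ExtMod X Z) : Prop :=
  forall i, (i < n)%N -> x i = 0.

End TotalExt.

(* [S] is meant to be a submodule of [M]. *)
Definition fg_right_module (R : pzRingType) (M : lmodType R^c) (S : M -> Prop) :=
  exists s : seq M, (forall x, x \in s -> S x) /\
    forall x, S x -> exists c : nat -> R,
      x = \sum_(i < size s) (c i : R^c) *: s`_i.

Definition right_ideal (R : pzRingType) (I : R -> Prop) :=
  [/\ I 0, (forall x y, I x -> I y -> I (x + y)) &
      forall x r, I x -> I (x * r)].

Definition right_noetherian (R : pzRingType) :=
  forall I : R -> Prop, right_ideal I ->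
    exists s : seq R, (forall x, x \in s -> I x) /\
      forall x, I x -> exists c : nat -> R, x = \sum_(i < size s) s`_i * c i.

Record functor (C D : preadditive) := Functor {
  fobj :> C -> D;
  fmap : forall X Y : C, Mor X Y -> Mor (fobj X) (fobj Y);
  fmap1 : forall X, fmap (idm X) = idm (fobj X);
  fmapM : forall X Y Z (g : Mor Y Z) (f : Mor X Y),
    fmap (g ∘ f) = fmap g ∘ fmap f }.

Arguments fmap {_ _} _ {_ _} _.

(* Additivity is a consequence, see [fmapD]. *)
Definition exact_functor (C D : preadditive) (F : functor C D) :=
  forall (X Y Z : C) (f : Mor X Y) (g : Mor Y Z),
    exact f g -> exact (fmap F f) (fmap F g).

Definition preserves_projectives (C D : preadditive) (F : functor C D) :=
  forall P : C, projective_obj P -> projective_obj (F P).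

Section ExactFunctor.
Variables (C D : epAbelianCategory) (F : functor C D) (hF : exact_functor F).
Implicit Types X Y Z : C.

Lemma exact_fmap_comp X Y Z (f : Mor X Y) (g : Mor Y Z) :
  exact f g -> fmap F g ∘ fmap F f = 0.
Proof. by move=> /hF /exact_comp. Qed.

Lemma fmap0 X Y : fmap F (0 : Mor X Y) = 0.
Proof.
have [O [toO fromO]] := has_zero_object (ab_abelian C).
have O0 : idm O = 0 by apply: toO.
have exO : exact (idm O) (idm O).
  exists O, (idm O), (idm O); split; first by rewrite comp1m.
    by move=> W g h; rewrite !compm1.
  split; first by rewrite comp1m.
  by move=> W u _; exists u; split=> [|v _]; [rewrite comp1m | apply: toO].
have FO : idm (F O) = 0 by have := exact_fmap_comp exO; rewrite fmap1 comp1m.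
have -> : (0 : Mor X Y) = (0 : Mor O Y) ∘ (idm O ∘ (0 : Mor X O)).
  by rewrite comp0m.
by rewrite !fmapM fmap1 FO comp0m compm0.
Qed.

Lemma fmap_epi X Y (e : Mor X Y) : epi e -> epi (fmap F e).
Proof.
move=> ee; have exe : exact e (0 : Mor Y Y).
  exists Y, e, (idm Y); split=> //; first by rewrite comp1m.
  split; first by rewrite comp0m.
  by move=> W u _; exists u; split=> [|v ->]; rewrite ?comp1m.
have [I [e' [m [-> ee' [_ km]]]]] := hF exe.
have [|v [mv _]] := km _ (idm (F Y)); first by rewrite fmap0 comp0m.
move=> W g h; rewrite !compA => /ee' gh.
by rewrite -[g]compm1 -[h]compm1 mv !compA gh.
Qed.

Lemma fmapD X Y (f g : Mor X Y) : fmap F (f + g) = fmap F f + fmap F g.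
Proof.
have [S [i1 [i2 [p1 [p2 [p1i1 p2i2 p1i2 p2i1 ipE]]]]]] :=
  has_biproducts (ab_abelian C) X X.
have ex1 : exact i1 p2.
  exists X, (idm X), i1; split; first by rewrite compm1.
    by move=> W a b; rewrite !compm1.
  split=> // W u p2u; exists (p1 ∘ u); split.
    by rewrite -[LHS]comp1m -ipE compDl -!compA p2u compm0 addr0.
  by move=> v ->; rewrite compA p1i1 comp1m.
have F1 : fmap F p1 ∘ fmap F i1 = idm (F X) by rewrite -fmapM p1i1 fmap1.
have F2 : fmap F p2 ∘ fmap F i2 = idm (F X) by rewrite -fmapM p2i2 fmap1.
have F12 : fmap F p1 ∘ fmap F i2 = 0 by rewrite -fmapM p1i2 fmap0.
have F21 : fmap F p2 ∘ fmap F i1 = 0 by rewrite -fmapM p2i1 fmap0.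
have FE : fmap F i1 ∘ fmap F p1 + fmap F i2 ∘ fmap F p2 = idm (F S).
  apply/esym/eqP; rewrite -subr_eq0; apply/eqP.
  set b := _ - _; have b1 : fmap F p1 ∘ b = 0.
    by rewrite /b compBr compDr compm1 !compA F1 F12 comp1m comp0m addr0 subrr.
  have b2 : fmap F p2 ∘ b = 0.
    by rewrite /b compBr compDr compm1 !compA F2 F21 comp1m comp0m add0r subrr.
  have [I [e [m [i1E ee [_ km]]]]] := hF ex1.
  have [v [bE _]] := km _ _ b2.
  have em : e ∘ fmap F p1 ∘ m = idm I.
    by apply: ee; rewrite -!compA -i1E F1 compm1 comp1m.
  by rewrite bE -[v]comp1m -em !compA -i1E -!compA -bE b1 !compm0.
pose h := f ∘ p1 + g ∘ p2.
have -> : f + g = h ∘ (i1 + i2).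
  rewrite /h compDl !compDr -!compA p1i1 p1i2 p2i1 p2i2.
  by rewrite !compm0 !compm1 addr0 add0r.
rewrite fmapM -[fmap F h]compm1 -FE compDr !compA -!fmapM compDl -!fmapM.
congr (fmap F _ + fmap F _); rewrite -!compA compDr ?p1i1 ?p1i2 ?p2i1 ?p2i2.
  by rewrite addr0 compm1 /h compDl -!compA p1i1 p2i1 compm0 addr0 compm1.
by rewrite add0r compm1 /h compDl -!compA p1i2 p2i2 compm0 add0r compm1.
Qed.

Lemma fmapB X Y (f g : Mor X Y) : fmap F (f - g) = fmap F f - fmap F g.
Proof. by apply: (addIr (fmap F g)); rewrite -fmapD !subrK. Qed.

Lemma fmap_cx_dd (A : complex C) n :
  fmap F (cx_d A n) ∘ fmap F (cx_d A n.+1) = 0.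
Proof. by rewrite -fmapM cx_dd fmap0. Qed.

Definition fmap_cx (A : complex C) : complex D :=
  Complex (fun n => fmap_cx_dd A n).

Definition fmap_res X (E : resolution X) : resolution (F X) :=
  @Resolution D (F X) (fmap_cx E) (fmap F (res_aug E))
    (fmap_epi (@res_aug_epi _ _ E)) (hF (res_exact0 E))
    (fun n => hF (res_exact E n)).

Lemma fmap_cocycle_subproof (A : complex C) n Y (f : cocycles A n Y) :
  fmap F f ∘ cx_d (fmap_cx A) n = 0.
Proof. by rewrite -fmapM cocycleP fmap0. Qed.

Definition fmap_cocycle (A : complex C) n Y (f : cocycles A n Y) :
  cocycles (fmap_cx A) n (F Y) := mkcocycle (fmap_cocycle_subproof f).

(* If [P] is the chosen projective resolution of [X] then [F P] is a resolution
   of [F X], and the class of [f : P n -> Y] is sent to that of [F f]. *)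
Definition ext_map n X Y (x : Ext n X Y) : Ext n (F X) (F Y) :=
  ext_class (E := fmap_res (PR X)) (fmap_cocycle (ext_repr x)).

Lemma fmap_is_coboundary (A : complex C) n Y (f : Mor (A n) Y) :
  is_coboundary f -> @is_coboundary D (fmap_cx A) n (F Y) (fmap F f).
Proof.
case: n f => [|n] f /= => [->|[g ->]]; first exact: fmap0.
by exists (fmap F g); rewrite fmapM.
Qed.

Lemma ext_map_pi n X Y (f : cocycles (PR X) n Y) :
  ext_map (ext_pi f) = ext_class (E := fmap_res (PR X)) (fmap_cocycle f).
Proof.
apply: ext_class_coboundary; rewrite /= -fmapB.
exact: (fmap_is_coboundary (ext_repr_pi f)).
Qed.

End ExactFunctor.

Record adjunction (C D : preadditive) (F : functor C D) (G : functor D C) :=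
  Adjunction {
    adj : forall (X : C) (Y : D), Mor (F X) Y -> Mor X (G Y);
    adj_inv : forall (X : C) (Y : D), Mor X (G Y) -> Mor (F X) Y;
    adjK : forall X Y, cancel (@adj X Y) (@adj_inv X Y);
    adj_invK : forall X Y, cancel (@adj_inv X Y) (@adj X Y);
    adj_natl : forall (X X' : C) (Y : D) (u : Mor X' X) (f : Mor (F X) Y),
      adj (f ∘ fmap F u) = adj f ∘ u;
    adj_natr : forall (X : C) (Y Y' : D) (v : Mor Y Y') (f : Mor (F X) Y),
      adj (v ∘ f) = fmap G v ∘ adj f }.

Section AdjunctionCocycle.
Variables (C D : epAbelianCategory) (F : functor C D) (G : functor D C).
Variables (psi : adjunction F G) (hF : exact_functor F).

Lemma adj0 (X : C) (Y : D) : adj psi (0 : Mor (F X) Y) = 0.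
Proof. by rewrite -(comp0m Y (fmap F (0 : Mor X X))) adj_natl compm0. Qed.

Lemma adj_cocycle_subproof (A : complex C) n (Y : D)
    (f : cocycles (fmap_cx hF A) n Y) :
  (adj psi f : Mor (A n) (G Y)) ∘ cx_d A n = 0.
Proof. by rewrite -adj_natl (cocycleP f) adj0. Qed.

Definition adj_cocycle (A : complex C) n (Y : D)
    (f : cocycles (fmap_cx hF A) n Y) : cocycles A n (G Y) :=
  mkcocycle (adj_cocycle_subproof f).

End AdjunctionCocycle.

(* Main.v *)
(* Since [F] is exact and preserves projectives, it sends a projective resolution
   [P] of [X] to one of [F X], and the adjunction identifies the cochain complex
   [Mor (F P, Y)] with [Mor (P, G Y)]; this gives (a).  A chain map lifting a
   cocycle of [P] is sent by [F] to one lifting its image, so naturality of the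
   adjunction gives (b).  By (b), the inverse isomorphism on total Ext is
   semilinear along [F : Ext^*(X, X) -> Ext^*(F X, F X)]; it therefore carries
   generators to generators, which is (c).  For (d), the preimage of a right
   ideal of [Ext^*(F X, F X)] is a submodule of the Noetherian module
   [Ext^*(X, G (F X))]. *)

Require Import Defs.
From HB Require Import structures.
From mathcomp Require Import all_boot all_order all_algebra.
From mathcomp Require Import boolp.

Set Implicit Arguments.
Unset Strict Implicit.
Unset Printing Implicit Defensive.

Import GRing.Theory.
Local Open Scope ring_scope.

(* [ssrfun.compA] shadows the associativity of [∘]. *)
Local Notation compA := Defs.compA.

(** * Composition of chain maps over a morphism *)

Section LiftsComposition.
Variable C : preadditive.

Lemma lifts_comp (A : complex C) (Y Y' : C) (E : resolution Y)
    (E' : resolution Y') (v : Mor Y Y') f phi mu :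
  lifts (A := A) (E := E) f phi -> lifts (E := E') (v ∘ res_aug E) mu ->
  lifts (E := E') (v ∘ f) (fun i => mu i ∘ phi i).
Proof.
move=> [pf dp] [qg dq]; split=> [|i]; first by rewrite compA qg -compA pf.
by rewrite compA dq -!compA dp.
Qed.

Lemma lifts_comp_id (A : complex C) (Y : C) (E E' : resolution Y) f phi mu :
  lifts (A := A) (E := E) f phi -> lifts (E := E') (res_aug E) mu ->
  lifts (E := E') f (fun i => mu i ∘ phi i).
Proof.
by move=> pf; rewrite -[res_aug E]comp1m -[f]comp1m; apply: lifts_comp.
Qed.

Lemma lifts_shift_comp (A A' : complex C) m (Y : C) (E : resolution Y)
    (f : Mor (A m) Y) phi (mu : forall i, Mor (A' i) (A i)) :
  (forall i, cx_d A i ∘ mu i.+1 = mu i ∘ cx_d A' i) ->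
  lifts (A := shift_cx m A) (E := E) f phi ->
  lifts (A := shift_cx m A') (E := E) (f ∘ mu m)
    (fun i => phi i ∘ mu (i + m)%N).
Proof.
move=> dmu [pf dp]; split=> [|i]; first by rewrite compA pf.
by rewrite compA dp -!compA -dmu.
Qed.

End LiftsComposition.

(** * Ext computed on arbitrary resolutions *)

Section ExtClass.
Variable C : epAbelianCategory.
Implicit Types X Y : C.

(** Composing [mu] with the chosen comparison map into [E] gives a comparison map into [E'], and any
    such map computes [ext_class]. *)
Lemma ext_class_chain X (E E' : resolution X) n Y (z : cocycles E' n Y) mu
    (pmu : lifts (A := E) (E := E') (res_aug E) mu) :
  ext_class (chain_cocycle pmu z) = ext_class z.
Proof.
have qf := chain_liftP (@PR_proj C X) E (exact_comp (res_exact0 (PR X))).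
rewrite (ext_classE z (lifts_comp_id qf pmu)).
by congr ext_pi; apply/val_inj; rewrite /= -compA.
Qed.

(** A projective [E] maps to [PR X] over the identity of [X]; pulling a representative of [x] back
    along this map gives [f]. *)
Lemma ext_class_surj X (E : resolution X) n Y (x : Ext n X Y) :
  projective_cx E -> exists f : cocycles E n Y, x = ext_class f.
Proof.
move=> pE.
have [mu pmu] := lift_exists pE (PR X) (exact_comp (res_exact0 E)).
exists (chain_cocycle pmu (ext_repr x)).
by rewrite ext_class_chain ext_class_PR ext_reprK.
Qed.

Lemma ext_push_class X (E : resolution X) n Y Y' (v : Mor Y Y')
    (f : cocycles E n Y) (g : cocycles E n Y') :
  cocv g = v ∘ f -> ext_push v (ext_class f) = ext_class g.
Proof. by move=> gE; apply: ext_push_pi; rewrite /= gE compA. Qed.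

(** The routes from [PR X'] to [E] through [PR X] and through [E'] both lie over [u], hence give
    cohomologous cocycles. *)
Lemma ext_pull_class X X' (E : resolution X) (E' : resolution X') n Y
    (u : Mor X' X) (f : cocycles E n Y) mu
    (pmu : lifts (A := E') (E := E) (u ∘ res_aug E') mu) :
  ext_pull u (ext_class f) = ext_class (chain_cocycle pmu f).
Proof.
have [phi pphi] := lift_exists (@PR_proj C X') (PR X) (aug_pull_cocycle u).
rewrite /ext_class (ext_pull_pi _ pphi); apply: ext_pi_eq => /=.
set lam := chain_lift _ _ _; have lamP : lifts _ lam := chain_liftP _ _ _.
set lam' := chain_lift _ _ _; have lamP' : lifts _ lam' := chain_liftP _ _ _.
rewrite -!compA.
exact: (lifts_eq_coboundary (@PR_proj C X') f (lifts_comp_id pphi lamP)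
  (lifts_comp lamP' pmu)).
Qed.

(** This allows products to be computed on resolutions such as [F (PR X)]. From the shifted [PR X']
    one reaches [E] through [PR X] by [chi], or through the shifted [E'] by [phi]; both chain maps
    lift the same cocycle. *)
Lemma yoneda_class n m X X' Y (E : resolution X) (E' : resolution X')
    (g : cocycles E n Y) (f : cocycles E' m X) phi
    (pf : lifts (A := shift_cx m E') (E := E) f phi) :
  yoneda (ext_class g) (ext_class f) =
  ext_class (unshift_cocycle (chain_cocycle pf g)).
Proof.
have [chi pchi] := lifts_of (chain_cocycle (chain_liftP (@PR_proj C X') E'
  (exact_comp (res_exact0 (PR X')))) f).
rewrite /ext_class (yoneda_pi _ pchi); apply: ext_pi_eq => /=.
move: pchi => /=.
set lam := chain_lift _ _ _; have lamP : lifts _ lam := chain_liftP _ _ _.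
set lam' := chain_lift _ _ _; have lamP' : lifts _ lam' := chain_liftP _ _ _.
move=> pchi; rewrite -!compA; apply: is_coboundary_shift.
exact: (lifts_eq_coboundary (@PR_shift_proj C X' m) g
  (lifts_comp_id pchi lamP') (lifts_shift_comp lamP.2 pf)).
Qed.

End ExtClass.

(** * The adjunction on morphisms and cochains *)

Section ExtAdjunction.
Variables (C D : epAbelianCategory) (F : functor C D) (G : functor D C).
Variables (psi : adjunction F G).

Lemma adj_inv_natl (X X' : C) (Y : D) (u : Mor X' X) (f : Mor X (G Y)) :
  adj_inv psi (f ∘ u) = adj_inv psi f ∘ fmap F u.
Proof.
by apply: (can_inj (@adjK _ _ _ _ psi _ _)); rewrite adj_natl !adj_invK.
Qed.

Lemma adj_inv0 (X : C) (Y : D) : adj_inv psi (0 : Mor X (G Y)) = 0.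
Proof. by rewrite -[LHS]compm1 -(adj0 psi X Y) adjK compm1. Qed.

Hypothesis hF : exact_functor F.

(* [f + g] is [(f, g) : F (X + X) -> Y] after [F] of the diagonal, and [psi] is
   natural in [X]: this uses only that [F] is additive. *)
Lemma adjD (X : C) (Y : D) : {morph @adj _ _ _ _ psi X Y : f g / f + g}.
Proof.
move=> f g.
have [S [i1 [i2 [p1 [p2 [p1i1 p2i2 p1i2 p2i1 _]]]]]] :=
  has_biproducts (ab_abelian C) X X.
pose h := f ∘ fmap F p1 + g ∘ fmap F p2.
have h1 : h ∘ fmap F i1 = f.
  rewrite /h compDl -!compA -!fmapM p1i1 p2i1 fmap1 (fmap0 hF).
  by rewrite compm1 compm0 addr0.
have h2 : h ∘ fmap F i2 = g.
  rewrite /h compDl -!compA -!fmapM p1i2 p2i2 fmap1 (fmap0 hF).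
  by rewrite compm1 compm0 add0r.
by rewrite -{1}h1 -{1}h2 -compDr -(fmapD hF) adj_natl compDr -!adj_natl h1 h2.
Qed.

Lemma adjB (X : C) (Y : D) : {morph @adj _ _ _ _ psi X Y : f g / f - g}.
Proof. by move=> f g; apply: (addIr (adj psi g)); rewrite -adjD !subrK. Qed.

Lemma adj_invB (X : C) (Y : D) : {morph @adj_inv _ _ _ _ psi X Y : f g / f - g}.
Proof.
move=> f g; apply: (can_inj (@adjK _ _ _ _ psi _ _)).
by rewrite adjB !adj_invK.
Qed.

Lemma adj_is_coboundary (A : complex C) n (Y : D)
    (f : Mor (fmap_cx hF A n) Y) :
  is_coboundary f -> @is_coboundary C A n (G Y) (adj psi f).
Proof.
case: n f => [|n] f /= => [->|[g ->]]; first exact: adj0.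
by exists (adj psi g); rewrite -adj_natl.
Qed.

Lemma adj_inv_is_coboundary (A : complex C) n (Y : D) (f : Mor (A n) (G Y)) :
  is_coboundary f -> @is_coboundary D (fmap_cx hF A) n Y (adj_inv psi f).
Proof.
case: n f => [|n] f /= => [->|[g ->]]; first exact: adj_inv0.
by exists (adj_inv psi g); rewrite -adj_inv_natl.
Qed.

Lemma adj_inv_cocycle_subproof (A : complex C) n (Y : D)
    (f : cocycles A n (G Y)) :
  (adj_inv psi f : Mor (fmap_cx hF A n) Y) ∘ cx_d (fmap_cx hF A) n = 0.
Proof. by rewrite /= -adj_inv_natl (cocycleP f) adj_inv0. Qed.

Definition adj_inv_cocycle (A : complex C) n (Y : D)
    (f : cocycles A n (G Y)) : cocycles (fmap_cx hF A) n Y :=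
  mkcocycle (adj_inv_cocycle_subproof f).

Lemma fmap_lifts (A : complex C) (X : C) (E : resolution X)
    (f : Mor (A 0) X) phi :
  lifts (E := E) f phi ->
  lifts (A := fmap_cx hF A) (E := fmap_res hF E) (fmap F f)
    (fun i => fmap F (phi i)).
Proof.
by move=> [pf dp]; split=> [|i]; rewrite /= -fmapM ?pf// dp fmapM.
Qed.

(** Shifting and applying [F] commute by conversion on objects and differentials, which are all that
    [lifts] sees of the source. *)
Lemma fmap_lifts_shift (A : complex C) m (X : C) (E : resolution X)
    (f : Mor (A m) X) phi :
  lifts (A := shift_cx m A) (E := E) f phi ->
  lifts (A := shift_cx m (fmap_cx hF A)) (E := fmap_res hF E) (fmap F f)
    (fun i => fmap F (phi i)).
Proof. exact: fmap_lifts. Qed.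

(** * The isomorphism on Ext, its naturality and Yoneda products *)

Hypothesis hFproj : preserves_projectives F.

Lemma fmap_res_proj (X : C) (E : resolution X) :
  projective_cx E -> projective_cx (fmap_res hF E).
Proof. by move=> pE i; apply/hFproj/pE. Qed.

(* As [F (PR X)] is a projective resolution of [F X], a cocycle on [PR (F X)]
   may be moved to it and then transposed. *)
Definition ext_adj i (X : C) (Y : D) (x : Ext i (F X) Y) : Ext i X (G Y) :=
  ext_pi (adj_cocycle psi (chain_cocycle
    (chain_liftP (fmap_res_proj (@PR_proj C X)) (PR (F X))
       (exact_comp (res_exact0 (fmap_res hF (PR X)))))
    (ext_repr x))).

Definition ext_adj_inv i (X : C) (Y : D) (x : Ext i X (G Y)) : Ext i (F X) Y :=
  ext_class (E := fmap_res hF (PR X)) (adj_inv_cocycle (ext_repr x)).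

Lemma ext_adj_pi i (X : C) (Y : D) (z : cocycles (PR (F X)) i Y) phi
    (pf : lifts (A := fmap_res hF (PR X)) (E := PR (F X))
       (res_aug (fmap_res hF (PR X))) phi) :
  ext_adj (ext_pi z) = ext_pi (adj_cocycle psi (chain_cocycle pf z)).
Proof.
apply: ext_pi_eq; rewrite /= -adjB; apply: adj_is_coboundary.
set lam := chain_lift _ _ _; have lamP : lifts _ lam := chain_liftP _ _ _.
(* Inserting [z ∘ lam i] separates the change of representative from the change of chain map. *)
rewrite -(subrK (z ∘ lam i) (_ ∘ _)) -addrA -compBl.
apply: is_coboundaryD; first exact: is_coboundary_compr lamP (ext_repr_pi z).
exact: (lifts_eq_coboundary (fmap_res_proj (@PR_proj C X)) z lamP pf).
Qed.

(** Two chain maps from the projective [F (PR X)] to [F P] are compared: one through [PR (F X)], the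
    other [F] of a comparison map [PR X -> P]. Both lie over the identity of [F X], and [adj]
    preserves coboundaries. *)
Lemma ext_adj_class i (X : C) (Y : D) (P : resolution X)
    (f : cocycles (fmap_res hF P) i Y) :
  ext_adj (ext_class f) = ext_class (adj_cocycle psi f).
Proof.
have [phi pphi] := lift_exists (fmap_res_proj (@PR_proj C X)) (PR (F X))
  (exact_comp (res_exact0 (fmap_res hF (PR X)))).
rewrite /ext_class (ext_adj_pi _ pphi); apply: ext_pi_eq => /=.
set lam := chain_lift _ _ _; have lamP : lifts _ lam := chain_liftP _ _ _.
set mu := chain_lift _ _ _; have muP : lifts _ mu := chain_liftP _ _ _.
rewrite -adj_natl -adjB -compA; apply: adj_is_coboundary.
exact: (lifts_eq_coboundary (fmap_res_proj (@PR_proj C X)) f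
  (lifts_comp_id pphi lamP) (fmap_lifts muP)).
Qed.

Lemma ext_adj_inv_pi i (X : C) (Y : D) (g : cocycles (PR X) i (G Y)) :
  ext_adj_inv (ext_pi g) =
  ext_class (E := fmap_res hF (PR X)) (adj_inv_cocycle g).
Proof.
apply: ext_class_coboundary; rewrite /= -adj_invB.
exact/adj_inv_is_coboundary/ext_repr_pi.
Qed.

Lemma ext_adjD i (X : C) (Y : D) :
  {morph @ext_adj i X Y : x y / x + y}.
Proof.
move=> x y; rewrite -[x]ext_reprK -[y]ext_reprK -raddfD.
have [phi pf] := lift_exists (fmap_res_proj (@PR_proj C X)) (PR (F X))
  (exact_comp (res_exact0 (fmap_res hF (PR X)))).
rewrite !(ext_adj_pi _ pf) -raddfD; congr ext_pi.
by apply/val_inj; rewrite /= compDl adjD.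
Qed.

Lemma ext_adj_invK i (X : C) (Y : D) :
  cancel (@ext_adj_inv i X Y) (@ext_adj i X Y).
Proof.
move=> x; rewrite /ext_adj_inv ext_adj_class ext_class_PR.
rewrite -[RHS]ext_reprK; congr ext_pi.
by apply/val_inj; rewrite /= adj_invK.
Qed.

(** Every class comes from a cocycle on [F (PR X)], where both maps are plain transposition. *)
Lemma ext_adjK i (X : C) (Y : D) :
  cancel (@ext_adj i X Y) (@ext_adj_inv i X Y).
Proof.
move=> x.
have [f ->] := ext_class_surj x (fmap_res_proj (@PR_proj C X)).
rewrite ext_adj_class ext_class_PR ext_adj_inv_pi; congr ext_class.
by apply/val_inj; rewrite /= adjK.
Qed.

Lemma ext_adj_of_hom (X : C) (Y : D) (f : Mor (F X) Y) :
  ext_adj (ext_of_hom f) = ext_of_hom (adj psi f).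
Proof.
have [phi pf] := lift_exists (fmap_res_proj (@PR_proj C X)) (PR (F X))
  (exact_comp (res_exact0 (fmap_res hF (PR X)))).
rewrite /ext_of_hom (ext_adj_pi _ pf); congr ext_pi.
by apply/val_inj; rewrite /= -compA pf.1 adj_natl.
Qed.

(** If [mu] lies over [u], then [F mu] lies over [F u]; computing both pullbacks with these reduces
    the claim to naturality of [adj] on cocycles. *)
Lemma ext_adj_nat i (X X' : C) (Y Y' : D) (u : Mor X' X) (v : Mor Y Y')
    (x : Ext i (F X) Y) :
  ext_adj (ext_push v (ext_pull (fmap F u) x)) =
  ext_push (fmap G v) (ext_pull u (ext_adj x)).
Proof.
have [f ->] := ext_class_surj x (fmap_res_proj (@PR_proj C X)).
have [mu pmu] := lift_exists (@PR_proj C X') (PR X) (aug_pull_cocycle u).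
have Fmu : lifts (A := fmap_res hF (PR X')) (E := fmap_res hF (PR X))
    (fmap F u ∘ res_aug (fmap_res hF (PR X'))) (fun i => fmap F (mu i)).
  by rewrite /= -fmapM; apply: fmap_lifts.
rewrite (ext_pull_class f Fmu) ext_adj_class (ext_pull_class _ pmu).
pose h := chain_cocycle Fmu f.
have vh : (v ∘ h) ∘ cx_d (fmap_res hF (PR X')) i = 0.
  by rewrite -compA (cocycleP h) compm0.
rewrite (ext_push_class (g := mkcocycle vh))// ext_adj_class.
by apply/esym/ext_push_class; rewrite /= adj_natr adj_natl.
Qed.

Lemma yoneda_ext_adj_inv m n (X X' : C) (Y : D) (eta : Ext m X' X)
    (theta : Ext n X (G Y)) :
  yoneda (ext_adj_inv theta) (ext_map hF eta) =
  ext_adj_inv (yoneda theta eta).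
Proof.
rewrite -[eta]ext_reprK -[theta]ext_reprK.
have [phi pf] := lifts_of (ext_repr eta).
rewrite ext_map_pi ext_adj_inv_pi (yoneda_pi _ pf) ext_adj_inv_pi.
rewrite (yoneda_class (E' := fmap_res hF (PR X')) _
  (f := fmap_cocycle hF _) (fmap_lifts_shift pf)).
congr ext_class; apply/val_inj => /=; exact/esym/adj_inv_natl.
Qed.

(** * Passage to total Ext *)

Lemma ext_adj_invD i (X : C) (Y : D) :
  {morph @ext_adj_inv i X Y : x y / x + y}.
Proof.
move=> x y; apply: (can_inj (@ext_adjK i X Y)).
by rewrite ext_adjD !ext_adj_invK.
Qed.

Lemma ext_adj0 i (X : C) (Y : D) : ext_adj (0 : Ext i (F X) Y) = 0.
Proof. by apply: (addrI (ext_adj 0)); rewrite -ext_adjD !addr0. Qed.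

Lemma ext_adj_inv0 i (X : C) (Y : D) : ext_adj_inv (0 : Ext i X (G Y)) = 0.
Proof. by rewrite -[RHS]ext_adjK ext_adj0. Qed.

Lemma ext_map0 i (X Y : C) : ext_map hF (0 : Ext i X Y) = 0.
Proof.
rewrite -(raddf0 (@ext_pi C i X Y)) ext_map_pi.
rewrite -[RHS](raddf0 (@ext_pi D i (F X) (F Y))).
by apply: ext_pi_eq; rewrite /= (fmap0 hF) comp0m subrr; apply: is_coboundary0.
Qed.

Lemma ext_adj_inv_cast i j (e : i = j) (X : C) (Y : D) (x : Ext i X (G Y)) :
  ext_adj_inv (ext_cast e x) = ext_cast e (ext_adj_inv x).
Proof. by case: j / e. Qed.

Lemma tot_adj_fin (X : C) (Y : D) (x : ExtTot (F X) Y) :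
  exists N, forall i, (N <= i)%N -> ext_adj (x i) = 0.
Proof. by have [N xN] := dsum_fin x; exists N => i /xN ->; rewrite ext_adj0. Qed.

Definition tot_adj (X : C) (Y : D) (x : ExtMod (F X) Y) : ExtMod X (G Y) :=
  Dsum (tot_adj_fin x).

Lemma tot_adj_inv_fin (X : C) (Y : D) (x : ExtTot X (G Y)) :
  exists N, forall i, (N <= i)%N -> ext_adj_inv (x i) = 0.
Proof.
by have [N xN] := dsum_fin x; exists N => i /xN ->; rewrite ext_adj_inv0.
Qed.

Definition tot_adj_inv (X : C) (Y : D) (x : ExtMod X (G Y)) : ExtMod (F X) Y :=
  Dsum (tot_adj_inv_fin x).

Lemma tot_map_fin (X Y : C) (x : ExtTot X Y) :
  exists N, forall i, (N <= i)%N -> ext_map hF (x i) = 0.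
Proof. by have [N xN] := dsum_fin x; exists N => i /xN ->; rewrite ext_map0. Qed.

Definition tot_map (X Y : C) (x : ExtTot X Y) : ExtTot (F X) (F Y) :=
  Dsum (tot_map_fin x).

Lemma tot_adjK (X : C) (Y : D) : cancel (@tot_adj X Y) (@tot_adj_inv X Y).
Proof. by move=> x; apply: dsumP => i; apply: ext_adjK. Qed.

Lemma tot_adj_inv0 (X : C) (Y : D) : tot_adj_inv (0 : ExtMod X (G Y)) = 0.
Proof. by apply: dsumP => i; apply: ext_adj_inv0. Qed.

Lemma tot_adj_invD (X : C) (Y : D) :
  {morph @tot_adj_inv X Y : x y / x + y}.
Proof. by move=> x y; apply: dsumP => i; apply: ext_adj_invD. Qed.

Lemma tot_adj_invZ (X : C) (Y : D) (r : ExtRing X) (x : ExtMod X (G Y)) :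
  tot_adj_inv ((r : (ExtRing X)^c) *: x) =
  (tot_map r : (ExtRing (F X))^c) *: tot_adj_inv x.
Proof.
apply: dsumP => k; rewrite /= /tot_mul_fun.
rewrite (big_morph _ (@ext_adj_invD k X Y) (@ext_adj_inv0 k X Y)).
by apply: eq_bigr => i _; rewrite ext_adj_inv_cast -yoneda_ext_adj_inv.
Qed.

End ExtAdjunction.

(** * Finitely generated right modules and Noetherian rings *)

Section RightModules.
Implicit Types R : pzRingType.

Definition right_submodule R (M : lmodType R^c) (T : M -> Prop) :=
  [/\ T 0, (forall x y, T x -> T y -> T (x + y)) &
      forall (r : R) x, T x -> T ((r : R^c) *: x)].

Definition right_span R (M : lmodType R^c) (s : seq M) (x : M) :=
  exists c : nat -> R, x = \sum_(i < size s) (c i : R^c) *: s`_i.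

Lemma right_span_submodule R (M : lmodType R^c) (s : seq M) :
  right_submodule (right_span s).
Proof.
split=> [|x y [a ->] [b ->]|r x [a ->]].
- by exists (fun=> 0); rewrite big1// => i _; rewrite scale0r.
- exists (fun i => a i + b i); rewrite -big_split; apply: eq_bigr => i _.
  exact/esym/scalerDl.
- exists (fun i => a i * r); rewrite scaler_sumr; apply: eq_bigr => i _.
  by rewrite scalerA.
Qed.

Lemma right_span_mem R (M : lmodType R^c) (s : seq M) x :
  x \in s -> right_span s x.
Proof.
move=> /(nthP 0)[i si <-]; exists (fun j => (j == i)%:R).
rewrite (bigD1 (Ordinal si))//= eqxx scale1r big1 ?addr0// => j.
by rewrite -val_eqE /= => /negPf ->; rewrite scale0r.
Qed.

Lemma right_span_min R (M : lmodType R^c) (s : seq M) (T : M -> Prop) :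
  right_submodule T -> (forall x, x \in s -> T x) ->
  forall x, right_span s x -> T x.
Proof.
move=> [T0 TD TZ] sT x [c ->].
by apply: (big_ind T) => // i _; apply/TZ/sT/mem_nth.
Qed.

Lemma right_span_cons R (M : lmodType R^c) (a : M) s x :
  right_span (a :: s) x -> exists r : R, right_span s (x - (r : R^c) *: a).
Proof.
move=> [c ->]; exists (c 0%N), (fun i => c i.+1).
by rewrite big_ord_recl /= addrC addKr.
Qed.

Lemma right_submoduleB R (M : lmodType R^c) (T : M -> Prop) x y :
  right_submodule T -> T x -> T y -> T (x - y).
Proof.
move=> [_ TD TZ] Tx Ty; apply: TD => //.
by rewrite -scaleN1r; apply: (TZ (-1)).
Qed.

(* The first coefficients [r] of the elements of [T] form a right ideal; lifts
   of its generators, together with generators of [T] inside the span of the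
   tail, generate [T]. *)
Lemma right_noetherian_submodule R (M : lmodType R^c) (s : seq M)
    (T : M -> Prop) :
  right_noetherian R -> right_submodule T ->
  (forall x, T x -> right_span s x) -> fg_right_module T.
Proof.
move=> noeth; elim: s T => [|a s IH] T Tsub Ts.
  by exists [::]; split=> // x /Ts.
have [T0 TD TZ] := Tsub; have [S0 SD SZ] := right_span_submodule s.
(* A relation rather than a function, since the coefficient of [a] in an expansion of [x] need not
   be unique. *)
pose lift (r : R) x := T x /\ right_span s (x - (r : R^c) *: a).
have lift0 : lift 0 0 by split=> //; rewrite scale0r subrr.
have liftD r r' x x' : lift r x -> lift r' x' -> lift (r + r') (x + x').
  move=> [Tx xr] [Tx' xr']; split; first exact: TD.
  have -> : ((r + r' : R) : R^c) *: a = (r : R^c) *: a + (r' : R^c) *: a.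
    exact: (scalerDl a (r : R^c)).
  by rewrite opprD addrACA; apply: SD.
have liftZ r q x : lift r x -> lift (r * q) ((q : R^c) *: x).
  move=> [Tx xr]; split; first exact: TZ.
  by move: (SZ q _ xr); rewrite scalerBr scalerA.
have [|rs [rsI rsgen]] := noeth (fun r => exists x, lift r x).
  split=> [|r r' [x xr] [x' xr']|r q [x xr]]; first by exists 0.
    by exists (x + x'); apply: liftD.
  by exists ((q : R^c) *: x); apply: liftZ.
(* Choice of a lift for each scalar that has one; the default 0 is never reached on [rs]. *)
have [g gP] : exists g : R -> M, forall r, r \in rs -> lift r (g r).
  exists (fun r => if pselect (exists x, lift r x) is left e
    then sval (cid e) else 0) => r /rsI e.
  by case: pselect => // e'; apply: (svalP (cid e')).
have [||t [tT tgen]] := IH (fun x => T x /\ right_span s x).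
- split=> [//|x y [Tx sx] [Ty sy]|r x [Tx sx]].
    by split; [apply: TD|apply: SD].
  by split; [apply: TZ|apply: SZ].
- by move=> x [].
pose gen := map g rs ++ t; have [G0 GD GZ] := right_span_submodule gen.
exists gen; split=> [x|x Tx].
  by rewrite mem_cat => /orP[/mapP[r /gP[Tr _] ->]|/tT[]].
have [r xr] := right_span_cons (Ts _ Tx).
have [c rE] := rsgen r (ex_intro _ x (conj Tx xr)).
(* Reusing the coefficients that express [r] through [rs] makes [r] a first coefficient of [y] too,
   so [x - y] lies in [T] and in the span of [s], where [t] generates. *)
pose y := \sum_(i < size rs) (c i : R^c) *: g rs`_i.
have [Ty yr] : lift r y.
  rewrite rE; apply: (big_ind2 lift) => // [? ? ? ?|i _]; first exact: liftD.
  exact/liftZ/gP/mem_nth.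
rewrite -[x](subrK y); apply: (GD); last first.
  apply: (big_ind (right_span gen) G0 GD) => i _; apply: GZ.
  by apply: right_span_mem; rewrite mem_cat map_f// mem_nth.
apply: (right_span_min (s := t)) => [//|z zt|].
  by apply: right_span_mem; rewrite mem_cat zt orbT.
apply: tgen; split; first exact: right_submoduleB.
have -> : x - y = (x - (r : R^c) *: a) - (y - (r : R^c) *: a).
  by rewrite opprB addrA subrK.
exact: right_submoduleB (right_span_submodule s) xr yr.
Qed.

(** The images of the generators generate, with coefficients moved along [h]. *)
Lemma fg_right_module_transfer R R' (M : lmodType R^c) (M' : lmodType R'^c)
    (h : R -> R') (f : M -> M') (S : M -> Prop) (S' : M' -> Prop) :
  f 0 = 0 -> {morph f : x y / x + y} ->
  (forall (r : R) x, f ((r : R^c) *: x) = (h r : R'^c) *: f x) ->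
  (forall x, S x -> S' (f x)) ->
  (forall y, S' y -> exists2 x, S x & y = f x) ->
  fg_right_module S -> fg_right_module S'.
Proof.
move=> f0 fD fZ SS' S'S [s [sS sgen]]; exists (map f s); split.
  by move=> _ /mapP[x /sS xS ->]; apply: SS'.
move=> _ /S'S[x /sgen[c ->] ->]; exists (fun i => h (c i)).
rewrite (big_morph f fD f0) size_map; apply: eq_bigr => i _.
by rewrite fZ (nth_map 0).
Qed.

End RightModules.

(** * Finite generation along the adjunction *)

(** The predicate [S'] is arbitrary so as to serve both (c), with a degree bound, and (d), with a
    right ideal. *)
Lemma tot_adj_inv_fg (C D : epAbelianCategory) (F : functor C D)
    (G : functor D C) (psi : adjunction F G) (hF : exact_functor F)
    (hFproj : preserves_projectives F) (X : C) (Y : D)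
    (S' : ExtMod (F X) Y -> Prop) :
  fg_right_module (R := ExtRing X) (M := ExtMod X (G Y))
    (fun x => S' (tot_adj_inv psi hF hFproj x)) ->
  fg_right_module (R := ExtRing (F X)) (M := ExtMod (F X) Y) S'.
Proof.
apply: (@fg_right_module_transfer (ExtRing X) (ExtRing (F X))
  (ExtMod X (G Y)) (ExtMod (F X) Y) (@tot_map _ _ _ hF X X)
  (@tot_adj_inv _ _ _ _ psi hF hFproj X Y)) => //.
- exact: tot_adj_inv0.
- exact: tot_adj_invD.
- exact: tot_adj_invZ.
- by move=> y Sy; exists (tot_adj psi hF hFproj y); rewrite tot_adjK.
Qed.

Local Close Scope ring_scope.

Theorem proposition9p1 (C D : epAbelianCategory)
    (hC : enough_injectives C) (hD : enough_injectives D)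
    (F : functor C D) (G : functor D C) (psi : adjunction F G)
    (hF : exact_functor F) (hFproj : preserves_projectives F) :
  exists (Psi : forall i (X : C) (Y : D), Ext i (F X) Y -> Ext i X (G Y))
         (Psi_inv : forall i (X : C) (Y : D), Ext i X (G Y) -> Ext i (F X) Y),
    (* (a) *)
    ([/\ (forall (X : C) (Y : D) (f : Mor (F X) Y),
            Psi 0 X Y (ext_of_hom f) = ext_of_hom (adj psi f)),
         (forall i (X : C) (Y : D) (P : resolution X)
            (f : cocycles (fmap_res hF P) i Y), projective_cx P ->
            Psi i X Y (ext_class f) = ext_class (adj_cocycle psi f)),
         (forall i (X : C) (Y : D), {morph Psi i X Y : x y / (x + y)%R}),
         (forall i (X : C) (Y : D),
            cancel (Psi i X Y) (Psi_inv i X Y) /\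
            cancel (Psi_inv i X Y) (Psi i X Y)) &
         (forall i (X X' : C) (Y Y' : D) (u : Mor X' X) (v : Mor Y Y')
            (x : Ext i (F X) Y),
            Psi i X' Y' (ext_push v (ext_pull (fmap F u) x)) =
            ext_push (fmap G v) (ext_pull u (Psi i X Y x)))] /\
    (* (b) *)
     (forall m n (X X' : C) (Y : D) (eta : Ext m X' X) (theta : Ext n X (G Y)),
        yoneda (Psi_inv n X Y theta) (ext_map hF eta) =
        Psi_inv (n + m) X' Y (yoneda theta eta))) /\
    (* (c) *)
    ((forall n (X : C) (Y : D),
        fg_right_module (R := ExtRing X) (M := ExtMod X (G Y))
          (fun x => ext_ge n x) ->
        fg_right_module (R := ExtRing (F X)) (M := ExtMod (F X) Y)
          (fun x => ext_ge n x)) /\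
    (* (d) *)
     (forall X : C,
        right_noetherian (ExtRing X) ->
        fg_right_module (R := ExtRing X) (M := ExtMod X (G (F X)))
          (fun=> True) ->
        right_noetherian (ExtRing (F X)))).
Proof.
exists (@ext_adj C D F G psi hF hFproj), (@ext_adj_inv C D F G psi hF).
split; [split; [split|] | split].
- exact: ext_adj_of_hom.
- by move=> i X Y P f _; apply: ext_adj_class.
- exact: ext_adjD.
- by move=> i X Y; split; [apply: ext_adjK | apply: ext_adj_invK].
- exact: ext_adj_nat.
- by move=> *; apply: yoneda_ext_adj_inv.
- move=> n X Y fg.
  apply: (@tot_adj_inv_fg _ _ _ _ psi hF hFproj X Y (fun x => ext_ge n x)).
  (* In each degree [ext_adj_inv] is injective and sends 0 to 0, so the preimage of [ext_ge n] is
     [ext_ge n]. *)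
  congr fg_right_module: fg; apply: funext => x; apply: propext.
  split=> xn i /xn /=; first by move=> ->; apply: ext_adj_inv0.
  by move=> xi; rewrite -[x i](ext_adj_invK psi hF hFproj) xi ext_adj0.
- move=> X noeth [s [_ sgen]] I [I0 ID IM].
  (* Scaling over the converse ring is right multiplication, so both forms of finite generation
     agree by conversion. *)
  suff : fg_right_module (R := ExtRing (F X)) (M := ExtMod (F X) (F X)) I by [].
  apply: (@tot_adj_inv_fg _ _ _ _ psi hF hFproj X (F X) I).
  (* The preimage of [I] is closed under [r] because [I] is closed under right multiplication by
     [tot_map r]. *)
  apply: (right_noetherian_submodule (s := s)) noeth _ _ => [|x _].
    split=> [|x y Ix Iy|r x Ix]; first by rewrite tot_adj_inv0.
      by rewrite tot_adj_invD; apply: ID.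
    by rewrite tot_adj_invZ; apply: IM.
  exact: sgen.
Qed.
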